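(* Let $G$ be a $(v,k,\lambda)_0$ relative skew Hadamard difference set group with difference set $D$ and subgroup $H$. Then $$\{1\},\quad H\setminus\{1\},\quad D,\quad D^{-1}$$ are the principal sets of a commutative Schur ring over $G$.
   Context: A $(v,k,\lambda)$ difference set in a finite group $G$ with $|G|=v$ is a non-empty subset $D\subset G$ with $|D|=k$ such that every $1\neq g\in G$ occurs exactly $\lambda$ times in the multiset $\{xy^{-1}:x,y\in D\}$. For $X\subseteq G$ write $X^{-1}=\{x^{-1}:x\in X\}$. A finite group $G$ is a $(v,k,\lambda)_0$ relative skew Hadamard difference set group with difference set $D$ and subgroup $H$ if $D\subset G$ is a $(v,k,\lambda)$ difference set, $1\ne H\le G$, $D\cap D^{-1}=\emptyset$ and $G\setminus(D\cup D^{-1})=H$. A subset $X\subseteq G$ is identified with the element $\sum_{x\in X}x$ of the group algebra. A subring $\mathfrak S$ of $\mathbb C G$ is a Schur ring over $G$ if there is a partition $\mathcal K=\{C_i\}_{i=1}^r$ of $G$ such that $\mathfrak S$ is the linear span of $C_1,\dots,C_r$ and: (1) $\{1_G\}\in\mathcal K$; (2) $C^{-1}\in\mathcal K$ for each $C\in\mathcal K$; (3) $C_i\cdot C_j=\sum_k\lambda_{i,j,k}C_k$ for all $i,j\le r$, for some scalars $\lambda_{i,j,k}$. The sets $C_i$ are called the principal sets of $\mathfrak S$. *)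

(* Defs.v *)
From mathcomp Require Export all_boot all_order all_algebra all_fingroup.
From mathcomp Require Export all_character.
From mathcomp Require Export reals complex.

Set Implicit Arguments.
Unset Strict Implicit.
Unset Printing Implicit Defensive.

Import GroupScope.

Definition difference_set (gT : finGroupType) (G : {group gT}) (v k lambda : nat)
    (D : {set gT}) : Prop :=
  [/\ #|G| = v, D != set0, D \subset G, #|D| = k &
      forall g, g \in G -> g != 1 ->
        #|[set p in setX D D | p.1 * p.2^-1 == g]| = lambda].

(* D^-1 is the elementwise inverse of D. *)
Definition rel_skew_Hadamard0 (gT : finGroupType) (G : {group gT})
    (v k lambda : nat) (D : {set gT}) (H : {group gT}) : Prop :=
  [/\ difference_set G v k lambda D,
      H :!=: 1,
      H \subset G,
      D :&: D^-1 = set0 &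
      G :\: (D :|: D^-1) = H].

(* The group algebra FG is mathcomp's group_ring F G: the F-algebra of matrices
   spanned by the (faithful) regular representation of G. Linear subspaces of
   it are encoded, as in mxalgebra, by row spaces of matrices in 'A_(m, #|G|);
   gset_mx F G X is the group algebra element \sum_(x in X) x. *)
Definition group_ring_subring (F : fieldType) (gT : finGroupType)
    (G : {group gT}) (m : nat) (S : 'A[F]_(m, #|G|)) : Prop :=
  [/\ (S <= group_ring F G)%MS,
      (1%:M \in S)%MS &
      forall a b : 'M[F]_#|G|,
        (a \in S)%MS -> (b \in S)%MS -> (a *m b \in S)%MS].

Definition gset_span (F : fieldType) (gT : finGroupType) (G : {group gT})
    (K : {set {set gT}}) : 'A[F]_#|G| :=
  (\sum_(X in K) <<mxvec (gset_mx F G X)>>)%MS.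

Definition Schur_ring_with_principal_sets (F : fieldType) (gT : finGroupType)
    (G : {group gT}) (m : nat) (S : 'A[F]_(m, #|G|)) (K : {set {set gT}}) : Prop :=
  [/\ group_ring_subring S /\ partition K G,
      (S :=: gset_span F G K)%MS,
      [set 1] \in K,
      forall X, X \in K -> X^-1 \in K &
      exists c : {set gT} -> {set gT} -> {set gT} -> F,
        forall X Y, X \in K -> Y \in K ->
          (gset_mx F G X *m gset_mx F G Y
             = \sum_(Z in K) c X Y Z *: gset_mx F G Z)%R].

(* Main.v *)
Require Import Defs.
From mathcomp Require Import zify ring.

Set Implicit Arguments.
Unset Strict Implicit.
Unset Printing Implicit Defensive.

Import GroupScope.

Import Order.TTheory GRing.Theory Num.Theory.

(** Write [h = #|H|] and identify a subset of [G] with its sum in the group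
    algebra, so that [G = H + D + D^-1] and [v = 2k + h].  Since [G] absorbs
    every factor and [D D^-1 = lambda G + (k - lambda)], every product of two of
    [H], [D], [D^-1] is under control as soon as [H D] and [D H] are.  The heart
    of the matter is therefore that [D] meets every coset of [H] other than [H]
    itself in exactly [h / 2] elements, which gives
    [H D = D H = (h / 2) (G - H)] and the same for [D^-1].

    This is a second moment computation.  Let [m g] be the number of elements of
    [D] in [H g].  Counting the pairs [(x, y)] of elements of [D] with [x y^-1]
    in [H] gives the sum of the squares of the [m g]; together with
    [k ^ 2 = k + lambda (v - 1)], one finds
      [(v - 1) * \sum_(g in G :\: H) (2 m g - h) ^ 2 = 2 h k (v - h ^ 2)].
    On the other hand [v = 2k + h] turns [k ^ 2 = k + lambda (v - 1)] into the
    statement that [v - 1] divides [h ^ 2 - 1]; as [h > 1], this forces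
    [v <= h ^ 2].  So the sum of squares is at most 0, and [2 m g = h] for every
    [g] outside [H] (lemma [card_rcosetI_half]).  The complement of [D] in such a
    coset [H g] lies in [D^-1], which therefore also has half of it, and
    inversion carries both counts over to left cosets.

    It remains to solve for the other products: [D D] from [D G],
    [D^-1 D] from [G D] (it equals [D D^-1]), and [D^-1 D^-1] from [G D^-1].
    Nothing depends on the coefficient field, whence the version over an
    arbitrary field, [rel_skew_Hadamard0_Schur_ring]. *)

(** * Coset intersections of a relative skew Hadamard difference set *)

Lemma sum_card_rcosetI (gT : finGroupType) (G H : {group gT}) (D : {set gT}) :
  H \subset G -> D \subset G ->
  (\sum_(g in G) #|D :&: H :* g| = #|D| * #|H|)%N.
Proof.
move=> sHG sDG.
have cardE g : #|D :&: H :* g| = (\sum_(d | (d \in D) && (g \in H :* d)) 1)%N.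
  by rewrite -sum1_card; apply: eq_bigl => d; rewrite inE rcoset_sym.
under eq_bigr => g _ do rewrite cardE.
rewrite (exchange_big_dep (mem D)) /=; last by move=> g d _ /andP[].
rewrite -sum_nat_const; apply: eq_bigr => d Dd.
rewrite -(card_rcoset H d) -sum1_card; apply: eq_bigl => g.
rewrite Dd /=; apply: andb_idl => /rcosetP[a Ha ->].
by apply: groupM; [apply: (subsetP sHG) | apply: (subsetP sDG)].
Qed.

(** Both square and product count the triples [(g, x, y)] with [x] and [y] in
    [D] and in [H g]: the pair [(x, y)] is eligible when [x y^-1] is in [H], and
    then [g] runs over the [#|H|] elements of [H x]. *)
Lemma sum_sqr_card_rcosetI (gT : finGroupType) (G H : {group gT})
    (D : {set gT}) :
  H \subset G -> D \subset G ->
  (\sum_(g in G) #|D :&: H :* g| ^ 2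
     = #|H| * #|[set p in setX D D | (p.1 * p.2^-1)%g \in H]|)%N.
Proof.
move=> sHG sDG.
have sq g : (#|D :&: H :* g| ^ 2
    = \sum_(p | (p \in [set p in setX D D | (p.1 * p.2^-1)%g \in H])
                && (g \in H :* p.1)) 1)%N.
  rewrite -mulnn -cardsX -sum1_card; apply: eq_bigl => -[x y].
  rewrite !inE /= (rcoset_sym H g x) -(mem_rcoset H y x).
  case: (x \in D) (y \in D) => [] [] //=; rewrite ?andbF //.
  case xg: (x \in H :* g); rewrite ?andbF //= andbT.
  by rewrite (rcoset_sym H x y) (rcoset_eqP xg).
under eq_bigr => g _ do rewrite sq.
rewrite (exchange_big_dep (mem [set p in setX D D | (p.1 * p.2^-1)%g \in H])) /=;
  last by move=> g p _ /andP[].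
rewrite mulnC -sum_nat_const; apply: eq_bigr => -[x y] Dp.
rewrite -(card_rcoset H x) -sum1_card; apply: eq_bigl => g.
rewrite Dp /=; apply: andb_idl => /rcosetP[a Ha ->].
move: Dp; rewrite !inE /= => /andP[/andP[Dx _] _].
by apply: groupM; [apply: (subsetP sHG) | apply: (subsetP sDG)].
Qed.

(** The diagonal accounts for the [k] representations of [1].  With [A = G] this is
    the parameter equation, with [A = H] the second moment of the coset
    intersections. *)
Lemma difference_set_count (gT : finGroupType) (G : {group gT})
    (v k lambda : nat) (D A : {set gT}) :
  difference_set G v k lambda D -> A \subset G -> 1%g \in A ->
  #|[set p in setX D D | (p.1 * p.2^-1)%g \in A]| = (k + lambda * #|A|.-1)%N.
Proof.
case=> _ _ sDG cD dD sAG A1.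
rewrite -sum1_card (partition_big (fun p => p.1 * p.2^-1) (mem A)) /=; last first.
  by move=> p; rewrite inE => /andP[].
rewrite (bigD1 1) //=; congr addn.
  rewrite -cD -(card_imset D (f := fun x => (x, x))); last by move=> x y [].
  rewrite -sum1_card; apply: eq_bigl => -[x y]; rewrite !inE /=.
  apply/idP/imsetP => [/andP[/andP[/andP[Dx Dy] _] /eqP xy]|[z Dz [-> ->]]].
    by exists x => //; rewrite -(mulgKV y x) xy mul1g.
  by rewrite mulgV A1 Dz eqxx.
rewrite (cardsD1 1 A) A1 /= mulnC -sum_nat_const.
rewrite (eq_bigl (mem (A :\ 1))) => [|g]; last by rewrite !inE andbC.
apply: eq_bigr => g; rewrite !inE => /andP[g1 Ag].
rewrite -(dD g (subsetP sAG _ Ag) g1) -sum1_card; apply: eq_bigl => p.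
rewrite !inE -andbA; congr andb; apply: andb_idl => /eqP ->; exact: Ag.
Qed.

Lemma card_rel_skew_Hadamard0 (gT : finGroupType) (G : {group gT})
    (v k lambda : nat) (D : {set gT}) (H : {group gT}) :
  rel_skew_Hadamard0 G v k lambda D H -> v = (2 * k + #|H|)%N.
Proof.
case=> -[cG _ sDG cD _] _ sHG DV0 defH.
have sUG : D :|: D^-1 \subset G by rewrite subUset sDG -(invGid G) invSg.
have := cardsID (D :|: D^-1) G.
rewrite (setIidPr sUG) defH cG cardsU DV0 cards0 card_invg cD subn0.
by rewrite mul2n -addnn => <-.
Qed.

(** Four times the parameter equation reads
    [(v - h) ^ 2 - 2 (v - h) = 4 lambda (v - 1)].  As [v] is 1 modulo [v - 1],
    this makes [h ^ 2 - 1] a multiple of [v - 1]; being positive, it is at least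
    [v - 1]. *)
Lemma order_le_sqr (v k lambda h : int) :
  (1 < h -> v = 2 * k + h -> 0 <= k -> k * k = k + lambda * (v - 1) ->
   v <= h ^+ 2)%R.
Proof.
move=> h1 ve k0 kk.
have dv : (h ^+ 2 - 1 = (4 * lambda - v + 1 + 2 * h) * (v - 1))%R.
  by move: kk; rewrite ve; lia.
move: dv; set t := (_ + 2 * h)%R => dv.
have h2 : (1 < h ^+ 2)%R by nia.
have t1 : (1 <= t)%R by nia.
nia.
Qed.

(** The second factor on the left is the sum of [(2 m g - h) ^ 2] over
    [G :\: H], expanded through the first two moments of the coset intersections
    [m g]; multiplying by [v - 1] lets the parameter equation eliminate
    [lambda]. *)
Lemma sum_sqr_deviation (v k lambda h : int) :
  (v = 2 * k + h -> k * k = k + lambda * (v - 1) ->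
   (v - 1) * (4 * (h * (k + lambda * (h - 1))) - 4 * h * (k * h)
               + h ^+ 2 * (v - h)) = 2 * h * k * (v - h ^+ 2))%R.
Proof.
move=> ve kk.
have -> : ((v - 1) * (4 * (h * (k + lambda * (h - 1))) - 4 * h * (k * h)
               + h ^+ 2 * (v - h)) = 4 * h * (v - 1) * k
               + 4 * h * (h - 1) * (lambda * (v - 1))
               + (v - 1) * (h ^+ 2 * (v - h) - 4 * h * (k * h)))%R by ring.
have -> : (lambda * (v - 1) = k * k - k)%R by rewrite kk; ring.
by rewrite ve; ring.
Qed.

(** The deviations from [h / 2] have nonpositive, hence zero, sum of squares. *)
Lemma card_rcosetI_half (gT : finGroupType) (G : {group gT})
    (v k lambda : nat) (D : {set gT}) (H : {group gT}) g :
  rel_skew_Hadamard0 G v k lambda D H -> g \in G :\: H ->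
  (2 * #|D :&: H :* g|)%N = #|H|.
Proof.
move=> sD GHg; have ve := card_rel_skew_Hadamard0 sD.
case: sD => dD H1 sHG DV0 defH; case: (dD) => cG _ sDG cD _.
have DH0 : D :&: H = set0.
  by apply/setP=> x; rewrite !inE -defH !inE; case: (x \in D).
have sum1 := sum_card_rcosetI sHG sDG.
have sum2 := sum_sqr_card_rcosetI sHG sDG.
rewrite (difference_set_count dD sHG (group1 H)) in sum2.
have kk : (k * k = k + lambda * v.-1)%N.
  rewrite -cG -(difference_set_count dD (subxx _) (group1 G)) -cD -cardsX.
  apply: eq_card => -[x y]; rewrite !inE /=.
  apply/esym/andb_idr => /andP[Dx Dy].
  by apply: groupM; rewrite ?groupV; apply: (subsetP sDG).
have h_gt1 : (1 < #|H|)%N by rewrite cardG_gt1.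
rewrite cD in sum1.
set h := #|H| in ve sum1 sum2 h_gt1 *.
pose m g := #|D :&: H :* g|; rewrite -/(m g).
pose dev : int := (\sum_(g in G :\: H) (2 * (m g)%:Z - h%:Z) ^+ 2)%R.
have mH x : x \in H -> m x = 0%N.
  by move=> Hx; rewrite /m rcoset_id // DH0 cards0.
have devE : (dev = 4 * (h%:Z * (k%:Z + lambda%:Z * (h%:Z - 1)))
     - 4 * h%:Z * (k%:Z * h%:Z) + h%:Z ^+ 2 * (v%:Z - h%:Z))%R.
  have sG : (\sum_(g in G) (2 * (m g)%:Z - h%:Z) ^+ 2
       = h%:Z ^+ 2 *+ h + dev)%R.
    rewrite (big_setID H) /= (setIidPr sHG) -/dev; congr (_ + _)%R.
    rewrite -sumr_const; apply: eq_bigr => x Hx.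
    by rewrite mH // mulr0 sub0r sqrrN.
  have -> : dev = (\sum_(g in G) (2 * (m g)%:Z - h%:Z) ^+ 2 - h%:Z ^+ 2 *+ h)%R.
    by rewrite sG addrC addKr.
  have -> : (\sum_(g in G) (2 * (m g)%:Z - h%:Z) ^+ 2
     = 4 * (\sum_(g in G) m g ^ 2)%N%:Z
       - 4 * h%:Z * (\sum_(g in G) m g)%N%:Z + h%:Z ^+ 2 *+ v)%R.
    rewrite !(big_morph Posz PoszD (erefl _)) !mulr_sumr -cG -sumr_const.
    rewrite -sumrB -big_split /=; apply: eq_bigr => x _.
    rewrite -mulnn PoszM; ring.
  have hZ : (h.-1%:Z = h%:Z - 1)%R by lia.
  rewrite sum1 sum2 -(mulr_natr _ v) -(mulr_natr _ h) !natz.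
  by rewrite !PoszM PoszD PoszM hZ; ring.
have dev0 : dev = 0%R.
  apply/eqP; rewrite eq_le sumr_ge0 ?andbT => [|x _]; last exact: sqr_ge0.
  have kkZ : (k%:Z * k%:Z = k%:Z + lambda%:Z * (v%:Z - 1))%R by lia.
  have veZ : (v%:Z = 2 * k%:Z + h%:Z)%R by lia.
  have := sum_sqr_deviation veZ kkZ; rewrite -devE.
  have := @order_le_sqr v k lambda h ltac:(lia) veZ ltac:(lia) kkZ.
  have : (0 < v%:Z - 1)%R by lia.
  have : (0 <= 2 * h%:Z * k%:Z)%R by lia.
  move=> hk0 v1 vh E.
  have : ((v%:Z - 1) * dev <= 0)%R by rewrite E mulr_ge0_le0 // subr_le0.
  by rewrite pmulr_rle0.
have := psumr_eq0P (fun x _ => sqr_ge0 _) dev0 GHg.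
move/eqP; rewrite sqrf_eq0; lia.
Qed.

(** A coset of [H] other than [H] is covered by [D] and [D^-1], so what [D] leaves
    is again one half. *)
Lemma card_rcosetI_half_inv (gT : finGroupType) (G : {group gT})
    (v k lambda : nat) (D : {set gT}) (H : {group gT}) g :
  rel_skew_Hadamard0 G v k lambda D H -> g \in G :\: H ->
  (2 * #|D^-1 :&: H :* g|)%N = #|H|.
Proof.
move=> sD GHg; have Dg := card_rcosetI_half sD GHg.
case: sD => _ _ sHG DV0 defH; have {GHg} [Gg nHg] := setDP GHg.
have sHgU : H :* g \subset D :|: D^-1.
  apply/subsetP => _ /rcosetP[a Ha ->].
  have : a * g \notin H by rewrite groupMl.
  rewrite -defH inE negb_and negbK orbC; case/orP => //.
  by rewrite groupM // (subsetP sHG).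
have : #|H :* g| = (2 * #|D :&: H :* g|)%N by rewrite card_rcoset Dg.
rewrite -Dg -{1}(setIidPr sHgU) setIUl cardsU setIACA DV0 set0I cards0 subn0.
by rewrite {1}mul2n -addnn => /addnI->.
Qed.

(** * Products of group sums *)

Lemma gset_mx_coef (F : fieldType) (gT : finGroupType) (G : {group gT})
    (X : {set gT}) : X \subset G ->
  gset_mx F G X = (\sum_(g in G) (g \in X)%:R *: regular_repr F G g)%R.
Proof.
move=> sXG; rewrite [RHS](big_setID X) /= (setIidPr sXG).
rewrite [X in (_ + X)%R]big1 ?addr0 => [|g]; last first.
  by rewrite inE => /andP[/negPf-> _]; rewrite scale0r.
by apply: eq_bigr => g ->; rewrite scale1r.
Qed.

(** The coefficient at [g] counts the [x] in [X] with [x^-1 g] in [Y].  In this form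
    a factor that is a subgroup turns it into a coset intersection; the mirror
    form [gset_mxM_rcoset] counts the right factor instead. *)
Lemma gset_mxM_lcoset (F : fieldType) (gT : finGroupType) (G : {group gT})
    (X Y : {set gT}) : X \subset G -> Y \subset G ->
  (gset_mx F G X *m gset_mx F G Y
     = \sum_(g in G) #|X :&: (g *: Y^-1)%g|%:R *: regular_repr F G g)%R.
Proof.
move=> sXG sYG; rewrite {1}/gset_mx mulmx_suml.
transitivity (\sum_(x in X) \sum_(g in G)
    ((x^-1 * g)%g \in Y)%:R *: regular_repr F G g)%R.
  apply: eq_bigr => x Xx; have Gx := subsetP sXG x Xx.
  rewrite gset_mx_coef // mulmx_sumr [RHS](reindex_inj (mulgI x)) /=.
  apply: eq_big => [g|g Gg]; first by rewrite groupMl.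
  by rewrite mulKg repr_mxM // scalemxAr.
rewrite exchange_big /=; apply: eq_bigr => g Gg.
rewrite -scaler_suml; congr (_ *: _)%R.
rewrite -sum1_card natr_sum big_mkcond [RHS]big_mkcond /=; apply: eq_bigr => x _.
rewrite inE mem_lcoset inE invMg invgK; case: (x \in X) => //=.
by case: (_ \in Y).
Qed.

Lemma gset_mxM_rcoset (F : fieldType) (gT : finGroupType) (G : {group gT})
    (X Y : {set gT}) : X \subset G -> Y \subset G ->
  (gset_mx F G X *m gset_mx F G Y
     = \sum_(g in G) #|Y :&: (X^-1 :* g)%g|%:R *: regular_repr F G g)%R.
Proof.
move=> sXG sYG; rewrite gset_mxM_lcoset //; apply: eq_bigr => g Gg.
congr (_%:R *: _)%R.
rewrite -(card_imset _ (f := fun x => x^-1 * g)); last first.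
  by move=> x y /mulIg/invg_inj.
apply: eq_card => y; rewrite !inE mem_rcoset inE invMg invgK.
apply/imsetP/andP => [[x]|[Yy Xy]].
  rewrite !inE mem_lcoset inE invMg invgK => /andP[Xx Yx] ->.
  by rewrite invMg invgK mulKVg.
exists (g * y^-1); last by rewrite invMg invgK mulgKV.
by rewrite !inE mem_lcoset inE Xy mulKg invgK.
Qed.

Lemma gset_mx1 (F : fieldType) (gT : finGroupType) (G : {group gT}) :
  gset_mx F G [set 1] = 1%:M%R.
Proof. by rewrite /gset_mx big_set1 repr_mx1. Qed.

Lemma gset_mxU (F : fieldType) (gT : finGroupType) (G : {group gT})
    (X Y : {set gT}) : X :&: Y = set0 ->
  (gset_mx F G (X :|: Y) = gset_mx F G X + gset_mx F G Y)%R.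
Proof.
move=> XY; rewrite /gset_mx -bigU; last by rewrite -setI_eq0 XY.
by apply: eq_bigl => x; rewrite !inE.
Qed.

Lemma gset_mxGM (F : fieldType) (gT : finGroupType) (G : {group gT})
    (X : {set gT}) : X \subset G ->
  (gset_mx F G G *m gset_mx F G X = #|X|%:R *: gset_mx F G G)%R.
Proof.
move=> sXG; rewrite gset_mxM_rcoset // scaler_sumr.
apply: eq_bigr => g Gg; rewrite invGid rcoset_id //.
by rewrite (setIidPl sXG).
Qed.

Lemma gset_mxMG (F : fieldType) (gT : finGroupType) (G : {group gT})
    (X : {set gT}) : X \subset G ->
  (gset_mx F G X *m gset_mx F G G = #|X|%:R *: gset_mx F G G)%R.
Proof.
move=> sXG; rewrite gset_mxM_lcoset // scaler_sumr.
apply: eq_bigr => g Gg; rewrite invGid lcoset_id //.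
by rewrite (setIidPl sXG).
Qed.

Lemma gset_mx_group_sqr (F : fieldType) (gT : finGroupType)
    (G H : {group gT}) : H \subset G ->
  (gset_mx F G H *m gset_mx F G H = #|H|%:R *: gset_mx F G H)%R.
Proof.
move=> sHG; rewrite gset_mxM_rcoset // gset_mx_coef // scaler_sumr invGid.
apply: eq_bigr => g Gg; rewrite scalerA -natrM; congr (_%:R *: _)%R.
have [Hg|nHg] := boolP (g \in H); first by rewrite muln1 rcoset_id // setIid.
rewrite muln0; apply/eqP; rewrite cards_eq0; apply/eqP/setP => x.
rewrite !inE mem_rcoset; apply/negP => /andP[Hx].
by rewrite groupMl // groupV (negPf nHg).
Qed.

Lemma gset_mx_group_mull (F : fieldType) (gT : finGroupType)
    (G H : {group gT}) (X : {set gT}) (m : nat) :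
  H \subset G -> X \subset G :\: H ->
  (forall g, g \in G :\: H -> #|X :&: H :* g| = m) ->
  (gset_mx F G H *m gset_mx F G X = m%:R *: gset_mx F G (G :\: H))%R.
Proof.
rewrite subsetD => sHG /andP[sXG XH0] Xm.
rewrite gset_mxM_rcoset // gset_mx_coef ?subsetDl // scaler_sumr invGid.
apply: eq_bigr => g Gg; rewrite scalerA -natrM inE Gg andbT; congr (_%:R *: _)%R.
have [Hg|nHg] := boolP (g \in H); last by rewrite muln1 Xm // inE nHg.
by rewrite muln0 rcoset_id // (disjoint_setI0 XH0) cards0.
Qed.

(** Inversion exchanges left and right cosets, so the hypothesis is about
    [X^-1]. *)
Lemma gset_mx_group_mulr (F : fieldType) (gT : finGroupType)
    (G H : {group gT}) (X : {set gT}) (m : nat) :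
  H \subset G -> X \subset G :\: H ->
  (forall g, g \in G :\: H -> #|X^-1 :&: H :* g| = m) ->
  (gset_mx F G X *m gset_mx F G H = m%:R *: gset_mx F G (G :\: H))%R.
Proof.
rewrite subsetD => sHG /andP[sXG XH0] Xm.
rewrite gset_mxM_lcoset // gset_mx_coef ?subsetDl // scaler_sumr invGid.
apply: eq_bigr => g Gg; rewrite scalerA -natrM inE Gg andbT; congr (_%:R *: _)%R.
have [Hg|nHg] := boolP (g \in H); last first.
  rewrite muln1 -(Xm g^-1); last by rewrite inE !groupV nHg.
  rewrite -card_invg; apply: eq_card => x.
  by rewrite !inE mem_lcoset mem_rcoset invgK -groupV invMg invgK.
by rewrite muln0 lcoset_id // (disjoint_setI0 XH0) cards0.
Qed.

Lemma gset_mx_difference_set (F : fieldType) (gT : finGroupType)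
    (G : {group gT}) (v k lambda : nat) (D : {set gT}) :
  difference_set G v k lambda D ->
  (gset_mx F G D *m gset_mx F G D^-1
     = lambda%:R *: gset_mx F G G + (k%:R - lambda%:R)%:M)%R.
Proof.
case=> _ _ sDG cD dD; have sVG : D^-1 \subset G by rewrite -(invGid G) invSg.
have -> : ((k%:R - lambda%:R)%:M = (k%:R - lambda%:R) *: gset_mx F G [set 1%g])%R.
  by rewrite gset_mx1 scalemx1.
rewrite gset_mxM_lcoset // invgK !gset_mx_coef ?sub1G //.
rewrite !scaler_sumr -big_split /=; apply: eq_bigr => g Gg.
rewrite !scalerA -scalerDl Gg mulr1 inE; congr (_ *: _)%R.
have [->|g1] := eqVneq g 1; first by rewrite lcoset1 setIid cD mulr1 addrC subrK.
rewrite mulr0 addr0 -(dD g Gg g1); congr (_%:R)%R.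
rewrite -(card_imset _ (f := fun x => (x, g^-1 * x))); last by move=> x y [].
apply: eq_card => -[x y]; apply/imsetP/idP => [[z]|].
  rewrite !inE mem_lcoset => /andP[Dz Dgz] [-> ->].
  by rewrite /= Dz Dgz invMg invgK mulKVg eqxx.
rewrite !inE /= => /andP[/andP[Dx Dy] /eqP gE].
have yE : g^-1 * x = y by rewrite -gE invMg invgK mulgKV.
by exists x; rewrite ?yE // inE Dx mem_lcoset yE.
Qed.

(** * Schur rings from the span of group sums *)

Lemma gset_spanP (F : fieldType) (gT : finGroupType) (G : {group gT})
    (K : {set {set gT}}) (a : 'M[F]_#|G|) :
  reflect (exists c : {set gT} -> F, a = \sum_(X in K) c X *: gset_mx F G X)%R
          (a \in gset_span F G K)%MS.
Proof.
apply: (iffP idP) => [/sub_sumsmxP[u aE]|[c ->]].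
  have ex X : exists c : F,
      (u X *m <<mxvec (gset_mx F G X)>>%MS = c *: mxvec (gset_mx F G X))%R.
    by apply/sub_rVP; rewrite -(genmxE (mxvec _)) submxMl.
  have [c cE] := fin_all_exists ex; exists c.
  apply: (can_inj mxvecK); rewrite aE linear_sum.
  by apply: eq_bigr => X _; rewrite cE linearZ.
rewrite linear_sum; apply: summx_sub => X KX.
by rewrite linearZ scalemx_sub // (sumsmx_sup X) // genmxE.
Qed.

Lemma gset_span_mul (F : fieldType) (gT : finGroupType) (G : {group gT})
    (K : {set {set gT}}) :
  (forall X Y, X \in K -> Y \in K ->
     (gset_mx F G X *m gset_mx F G Y \in gset_span F G K)%MS) ->
  forall a b : 'M[F]_#|G|, (a \in gset_span F G K)%MS ->
    (b \in gset_span F G K)%MS -> (a *m b \in gset_span F G K)%MS.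
Proof.
move=> KM a b /gset_spanP[c ->] /gset_spanP[d ->].
rewrite mulmx_suml linear_sum; apply: summx_sub => X KX.
rewrite mulmx_sumr linear_sum; apply: summx_sub => Y KY.
by rewrite -scalemxAl -scalemxAr !linearZ !scalemx_sub // KM.
Qed.

Lemma gset_span_comm (F : fieldType) (gT : finGroupType) (G : {group gT})
    (K : {set {set gT}}) :
  (forall X Y, X \in K -> Y \in K ->
     gset_mx F G X *m gset_mx F G Y = gset_mx F G Y *m gset_mx F G X)%R ->
  forall a b : 'M[F]_#|G|, (a \in gset_span F G K)%MS ->
    (b \in gset_span F G K)%MS -> (a *m b = b *m a)%R.
Proof.
move=> KC a b /gset_spanP[c ->] /gset_spanP[d ->].
rewrite mulmx_suml mulmx_sumr; apply: eq_bigr => X KX.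
rewrite mulmx_suml mulmx_sumr; apply: eq_bigr => Y KY.
by rewrite -!scalemxAl -!scalemxAr KC // !scalerA mulrC.
Qed.

(** Once the products of principal sets lie in the span, the structure constants
    exist pair by pair, and finiteness of the index type collects them into one
    function. *)
Lemma Schur_ring_gset_span (F : fieldType) (gT : finGroupType) (G : {group gT})
    (K : {set {set gT}}) :
  partition K G -> [set 1] \in K -> (forall X, X \in K -> X^-1 \in K) ->
  (forall X Y, X \in K -> Y \in K ->
     (gset_mx F G X *m gset_mx F G Y \in gset_span F G K)%MS) ->
  Schur_ring_with_principal_sets (gset_span F G K) K.
Proof.
move=> pK K1 KV KM; split=> //; last first.
  have ex (p : {set gT} * {set gT}) : exists c : {set gT} -> F,
      (p.1 \in K) && (p.2 \in K) ->
      (gset_mx F G p.1 *m gset_mx F G p.2 = \sum_(Z in K) c Z *: gset_mx F G Z)%R.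
    have [/andP[K_1 K_2]|_] := boolP (_ && _); last by exists (fun=> 0%R).
    by have /gset_spanP[c cE] := KM _ _ K_1 K_2; exists c.
  have [c cE] := fin_all_exists ex.
  exists (fun X Y => c (X, Y)) => X Y KX KY.
  by apply: (cE (X, Y)); rewrite KX KY.
split=> //; split; last exact: gset_span_mul.
  apply/sumsmx_subP => X KX; rewrite genmxE linear_sum; apply: summx_sub => x Xx.
  apply: envelop_mx_id; rewrite -(cover_partition pK).
  by apply/bigcupP; exists X.
by rewrite -gset_mx1 /gset_span (sumsmx_sup [set 1]) // genmxE.
Qed.

Lemma partition_rel_skew_Hadamard0 (gT : finGroupType) (G : {group gT})
    (v k lambda : nat) (D : {set gT}) (H : {group gT}) :
  rel_skew_Hadamard0 G v k lambda D H ->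
  partition [set [set 1]; H :\ 1; D; D^-1] G.
Proof.
case=> -[_ D0 sDG _ _] H1 sHG DV0 defH.
have sUG : D :|: D^-1 \subset G by rewrite subUset sDG -(invGid G) invSg.
have HUG : [set 1] :|: H :\ 1 :|: D :|: D^-1 = G.
  by rewrite setD1K // -setUA -defH setUC -{1}(setIidPr sUG) setID.
have DH x : x \in D -> x \notin H by move=> Dx; rewrite -defH !inE Dx.
have DVH x : x \in D^-1 -> x \notin H.
  by rewrite inE => Dx; rewrite -defH !inE Dx orbT.
have disjDV x : x \in D -> x \notin D^-1.
  by move=> Dx; apply/negP => DVx; have := in_set0 x; rewrite -DV0 inE Dx DVx.
have V0 : D^-1 != set0.
  by have [x Dx] := set0Pn _ D0; apply/set0Pn; exists x^-1; rewrite inE invgK.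
have HD10 : H :\ 1 != set0.
  by have /trivgPn[x Hx x1] := H1; apply/set0Pn; exists x; rewrite !inE x1.
apply/and3P; split.
- rewrite /cover; apply/eqP; rewrite -HUG.
  apply/setP=> x; apply/bigcupP/idP => [[X]|].
    by rewrite !inE -!orbA => /or4P[] /eqP-> ; rewrite ?inE => ->; rewrite ?orbT.
  rewrite !inE -!orbA => /or4P[] Xx.
  + by exists [set 1]; rewrite !inE ?eqxx.
  + by exists (H :\ 1); rewrite !inE ?eqxx ?orbT.
  + by exists D; rewrite ?inE ?eqxx ?orbT.
  + by exists D^-1; rewrite ?inE ?eqxx ?orbT.
- apply/trivIsetP => X Y.
  have dis (A B : {set gT}) : (forall x, x \in A -> x \notin B) -> [disjoint A & B].
    by move=> AB; apply/pred0P => x /=; apply/negP => /andP[/AB /negP].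
  have d1 : [disjoint [set 1] & H :\ 1] by apply: dis => x; rewrite !inE => ->.
  have d2 : [disjoint [set 1] & D].
    by apply: dis => x /set1P->; apply/negP => /DH; rewrite group1.
  have d3 : [disjoint [set 1] & D^-1].
    by apply: dis => x /set1P->; apply/negP => /DVH; rewrite group1.
  have d4 : [disjoint H :\ 1 & D].
    by apply: dis => x /setD1P[_ Hx]; apply/negP => /DH; rewrite Hx.
  have d5 : [disjoint H :\ 1 & D^-1].
    by apply: dis => x /setD1P[_ Hx]; apply/negP => /DVH; rewrite Hx.
  have d6 : [disjoint D & D^-1] by apply: dis.
  rewrite !inE -!orbA => /or4P[] /eqP-> /or4P[] /eqP->; rewrite ?eqxx // => _ //;
    by rewrite disjoint_sym.
- have ne (A : {set gT}) : A != set0 -> set0 != A by rewrite eq_sym.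
  have ne1 : [set 1] != set0 :> {set gT} by apply/set0Pn; exists 1; rewrite inE.
  by rewrite !inE !negb_or !ne.
Qed.

(** * The Schur ring *)

(** The sums of [1], [H], [D], [D^-1] span the same space as those of the
    principal sets and have the simpler multiplication table, so the products of
    principal sets are expanded through [H - 1]. *)
Lemma rel_skew_Hadamard0_Schur_ring (F : fieldType) (gT : finGroupType)
    (G : {group gT}) (v k lambda : nat) (D : {set gT}) (H : {group gT}) :
  rel_skew_Hadamard0 G v k lambda D H ->
  exists S : 'A[F]_#|G|,
    Schur_ring_with_principal_sets S [set [set 1]; H :\ 1; D; D^-1]
    /\ (forall a b : 'M[F]_#|G|,
          (a \in S)%MS -> (b \in S)%MS -> a *m b = b *m a)%R.
Proof.
move=> sD; have partK := partition_rel_skew_Hadamard0 sD.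
have halfD g := card_rcosetI_half (g := g) sD.
have halfV g := card_rcosetI_half_inv (g := g) sD.
case: sD => dD _ sHG DV0 defH; case: (dD) => _ _ sDG cD _.
have sVG : D^-1 \subset G by rewrite -(invGid G) invSg.
have DUV : D :|: D^-1 = G :\: H.
  rewrite -defH setDDr setDv set0U; apply/esym/setIidPr.
  by rewrite subUset sDG.
set K := [set _; _; _; _] in partK *; pose S := gset_span F G K.
pose h : 'M[F]_#|G| := gset_mx F G H.
pose d : 'M[F]_#|G| := gset_mx F G D; pose e : 'M[F]_#|G| := gset_mx F G D^-1.
pose t : 'M[F]_#|G| := gset_mx F G G.
have gDH : gset_mx F G (G :\: H) = (d + e)%R by rewrite -DUV gset_mxU.
have tE : t = (h + (d + e))%R.
  rewrite -gDH -gset_mxU; last first.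
    by apply/setP => x; rewrite !inE; case: (x \in H); rewrite ?andbF.
  by rewrite /t; congr (gset_mx F G _); rewrite -{1}(setID G H) (setIidPr sHG).
have gH1 : gset_mx F G (H :\ 1) = (h - 1%:M)%R.
  have -> : h = (1%:M + gset_mx F G (H :\ 1)%g)%R.
    rewrite -gset_mx1 -gset_mxU; last by apply/setP => x; rewrite !inE; case: eqP.
    by rewrite setD1K.
  by rewrite addrC addKr.
pose m := #|H|./2.
have sDGH : D \subset G :\: H by rewrite -DUV subsetUl.
have sVGH : D^-1 \subset G :\: H by rewrite -DUV subsetUr.
have mD x : x \in G :\: H -> #|D :&: H :* x| = m.
  by move=> /halfD; rewrite /m => <-; rewrite mul2n doubleK.
have mV x : x \in G :\: H -> #|D^-1 :&: H :* x| = m.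
  by move=> /halfV; rewrite /m => <-; rewrite mul2n doubleK.
have hd : (h *m d = m%:R *: (d + e))%R by rewrite -gDH; apply: gset_mx_group_mull.
have he : (h *m e = m%:R *: (d + e))%R by rewrite -gDH; apply: gset_mx_group_mull.
have dh : (d *m h = m%:R *: (d + e))%R by rewrite -gDH; apply: gset_mx_group_mulr.
have eh : (e *m h = m%:R *: (d + e))%R.
  by rewrite -gDH; apply: gset_mx_group_mulr; rewrite ?invgK.
have hh : (h *m h = #|H|%:R *: h)%R.
  exact: gset_mx_group_sqr.
have de : (d *m e = lambda%:R *: t + (k%:R - lambda%:R)%:M)%R.
  exact: (gset_mx_difference_set F dD).
have dt : (d *m t = k%:R *: t)%R by rewrite /d /t gset_mxMG // cD.
have td : (t *m d = k%:R *: t)%R by rewrite /d /t gset_mxGM // cD.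
have te : (t *m e = k%:R *: t)%R by rewrite /e /t gset_mxGM // card_invg cD.
(* Each product still missing is one of three summands of a product by
   [t = h + (d + e)]; this identity isolates it. *)
have subDD (x y z : 'M[F]_#|G|) : (x + (y + z) - x - y = z)%R.
  by rewrite (addrC x) addrK addrC addKr.
have dd : (d *m d = k%:R *: t - d *m h - d *m e)%R.
  by rewrite -dt tE !mulmxDr (addrC (d *m d)%R) subDD.
have ed : (e *m d = d *m e)%R.
  transitivity (k%:R *: t - h *m d - d *m d)%R.
    by rewrite -td tE !mulmxDl subDD.
  by rewrite dd hd dh subKr.
have ee : (e *m e = k%:R *: t - h *m e - d *m e)%R.
  by rewrite -te tE !mulmxDl subDD.
have addS (a b : 'M[F]_#|G|) : (a \in S -> b \in S -> (a + b)%R \in S)%MS.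
  by move=> Sa Sb; rewrite linearD addmx_sub.
have scaleS c (a : 'M[F]_#|G|) : (a \in S -> (c *: a)%R \in S)%MS.
  by move=> Sa; rewrite linearZ scalemx_sub.
have subS (a b : 'M[F]_#|G|) : (a \in S -> b \in S -> (a - b)%R \in S)%MS.
  by move=> Sa Sb; rewrite -scaleN1r addS ?scaleS.
have KS X : X \in K -> (gset_mx F G X \in S)%MS.
  by move=> KX; rewrite /S /gset_span (sumsmx_sup X) // genmxE.
have S1 : (1%:M \in S)%MS by rewrite -gset_mx1 KS // !inE eqxx.
have Sd : (d \in S)%MS by rewrite KS // !inE eqxx ?orbT.
have Se : (e \in S)%MS by rewrite KS // !inE eqxx ?orbT.
have Sh : (h \in S)%MS.
  by rewrite -(subrK 1%:M%R h) -gH1 addS // KS // !inE eqxx ?orbT.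
have St : (t \in S)%MS by rewrite tE !addS.
exists S; split.
  apply: Schur_ring_gset_span => //.
  - by rewrite !inE eqxx.
  - have HV : (H :\ 1)^-1 = H :\ 1.
      by apply/setP => x; rewrite !inE groupV invg_eq1.
    have oneV : [set 1]^-1 = [set 1] :> {set gT}.
      by apply/setP => x; rewrite !inE invg_eq1.
    move=> X; rewrite !inE -!orbA.
    by case/or4P => /eqP->; rewrite ?HV ?oneV ?invgK eqxx ?orbT.
  - have Sde : (d *m e \in S)%MS by rewrite de -scalemx1 addS ?scaleS.
    have Shd : (h *m d \in S)%MS by rewrite hd scaleS ?addS.
    have Sdd : (d *m d \in S)%MS by rewrite dd dh -hd !subS ?scaleS.
    have See : (e *m e \in S)%MS by rewrite ee he -hd !subS ?scaleS.
    have Shh : (h *m h \in S)%MS by rewrite hh scaleS.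
    move=> X Y; rewrite !inE -!orbA.
    by case/or4P => /eqP-> /or4P[] /eqP->; rewrite ?gset_mx1 ?gH1 -/d -/e
      ?mulmxBl ?mulmxBr ?mul1mx ?mulmx1 ?he ?dh ?eh -?hd ?ed ?subS.
apply: gset_span_comm => X Y; rewrite !inE -!orbA.
by case/or4P => /eqP-> /or4P[] /eqP->; rewrite ?gset_mx1 ?gH1 -/d -/e
  ?mulmxBl ?mulmxBr ?mul1mx ?mulmx1 ?hd ?dh ?he ?eh ?ed.
Qed.

Theorem theorem1p3 (R : realType) (gT : finGroupType) (G : {group gT})
    (v k lambda : nat) (D : {set gT}) (H : {group gT}) :
  rel_skew_Hadamard0 G v k lambda D H ->
  exists S : 'A[R[i]%C]_#|G|,
    Schur_ring_with_principal_sets S [set [set 1]; H :\ 1; D; D^-1]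
    /\ (forall a b : 'M[R[i]%C]_#|G|,
          (a \in S)%MS -> (b \in S)%MS -> a *m b = b *m a)%R.
Proof. exact: rel_skew_Hadamard0_Schur_ring. Qed.
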